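(* Let $T$ be a one-dimensional subtorus of $U_A$, $U_B$ or $U_C$ whose six speeds are nonzero and pairwise distinct in absolute value, and suppose $\mathrm{ML}(T)<1/6$. Write $\mathrm{ML}(T)=p/q$ in lowest terms and $k=q-6p$. Then $$\mathrm{ML}(T)=\frac{P-1}{6P}\qquad\text{for an integer }P\equiv\pm1\pmod 6;$$ consequently $k\in\{1,3\}$ and the denominator $q$ of $\mathrm{ML}(T)$ is odd. If $T\subseteq U_A$ or $T\subseteq U_B$, then $k=1$. If $T\subseteq U_C$ has parameters $(A,B)$ normalised by $A>0$, then $k=3$ exactly when one of the following holds: (1) $(A,B)\equiv(0,5)\pmod 6$ and $A+2B>0$ (that is, $B/A>-1/2$); (2) $(A,B)\equiv(0,1)\pmod 6$ and $5A+2B<0$ (that is, $B/A<-5/2$); (3) $(A,B)\equiv(5,1)\pmod 6$, $5A+3B>0$ and $A-B>0$ (that is, $-5/3<B/A<1$); (4) $(A,B)\equiv(5,2)\pmod 6$, $4A+B>0$ and $4A+3B<0$ (that is, $-4<B/A<-4/3$); and $k=1$ in all other cases. Moreover, $\max_i|v_i|<3q$ for every such $T\subseteq U_C$ (with $v=(v_1,\dots,v_6)$ the speed vector of $T$), and the constant $3$ is optimal (it cannot be replaced by any smaller constant).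
   Context: For real $x$, $\lVert x\rVert$ is the distance to the nearest integer; $\mathbb T^n=(\mathbb R/\mathbb Z)^n$; for closed $X\subseteq\mathbb T^n$, $\mathrm{ML}(X)=\sup_{x\in X}\min_{1\le r\le n}\lVert x_r\rVert$. For integer vectors, $\langle w\rangle_{\mathbb R}$ and $\langle u,v\rangle_{\mathbb R}$ denote the images in $\mathbb T^n$ of the real line spanned by $w$, respectively of the real plane spanned by $u,v$. Thus $\mathrm{ML}(\langle w\rangle_{\mathbb R})=\max_{t\in\mathbb R}\min_r\lVert tw_r\rVert$. Let $e_6=(0,0,0,0,0,1)$ and $$U_A=\langle(1,2,3,4,5,0),e_6\rangle_{\mathbb R},\quad U_B=\langle(1,3,4,5,9,0),e_6\rangle_{\mathbb R},\quad U_C=\langle(1,0,1,2,3,3),(0,1,1,1,1,2)\rangle_{\mathbb R}$$ in $\mathbb T^6$. In each case the two listed generators $u,v$ (in this order) span over $\mathbb Z$ the lattice of integer points of the plane $\mathbb Ru+\mathbb Rv$. The one-dimensional subtori of $U=\langle u,v\rangle_{\mathbb R}$ are exactly the $T=\langle Au+Bv\rangle_{\mathbb R}$ with $A,B$ coprime integers, two pairs giving the same subtorus if and only if they differ by a sign; $(A,B)$ are called the parameters of $T$ and $Au+Bv$ its speed vector, whose entries are the speeds of $T$. For $U_C$ the speed vector is $(A,\,B,\,A+B,\,2A+B,\,3A+B,\,3A+2B)$. *)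

(* Defs.v *)
From HB Require Import structures.
From mathcomp Require Import all_boot all_order all_algebra.
From mathcomp Require Import generic_quotient ring_quotient.
From mathcomp Require Import all_classical all_reals.

Set Implicit Arguments.
Unset Strict Implicit.
Unset Printing Implicit Defensive.

Import Order.TTheory GRing.Theory Num.Theory.

Local Open Scope classical_set_scope.
Local Open Scope ring_scope.

Definition dist_int (R : realType) (x : R) : R :=
  inf [set `|x - m%:~R| | m in [set: int]].

Definition Zsub (R : realType) :=
  GRing.ZmodClosed.clone R (@Num.int_num_subdef R) _.

(* Despite its name, [{ideal_quot I}] only requires [I] to be an additive
   subgroup; this is the additive group R/Z. *)
Definition RmodZ (R : realType) := {ideal_quot (Zsub R)}.

Definition to_RmodZ (R : realType) (x : R) : RmodZ R :=
  (\pi_(RmodZ R) x)%qT.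

Lemma to_RmodZP (R : realType) (x y : R) :
  to_RmodZ x = to_RmodZ y <-> exists m : int, x - y = m%:~R.
Proof.
rewrite /to_RmodZ; split=> [/eqP|[m xy]].
  by rewrite -Quotient.idealrBE => /intrP.
by apply/eqP; rewrite -Quotient.idealrBE xy; apply/intrP; exists m.
Qed.

(* Independent of the representative, see [normTE]. *)
Definition normT (R : realType) (a : RmodZ R) : R := dist_int (repr a).

Lemma normTE (R : realType) (x : R) : normT (to_RmodZ x) = dist_int x.
Proof.
have /to_RmodZP[k xk] : to_RmodZ (repr (to_RmodZ x)) = to_RmodZ x.
  by rewrite /to_RmodZ reprK.
rewrite /normT /dist_int; congr inf; apply/seteqP.
move: xk; set y := repr _ => /(canRL (subrK x)) ->.
split=> _ [m _ <-]; [exists (m - k) | exists (m + k)] => //; congr `|_|.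
  by rewrite intrB opprB addrCA addrA.
by rewrite [m + k]addrC intrD opprD addrACA subrr add0r.
Qed.

Definition torus (R : realType) (n : nat) := 'rV[RmodZ R]_n.

Definition to_torus (R : realType) (n : nat) (x : 'rV[R]_n) : torus R n :=
  map_mx (@to_RmodZ R) x.

Definition min_norm (R : realType) (n : nat) (x : torus R n.+1) : R :=
  \big[Num.min/normT (x ord0 ord0)]_(r < n.+1) normT (x ord0 r).

Definition ML (R : realType) (n : nat) (X : set (torus R n.+1)) : R :=
  sup [set min_norm x | x in X].

Definition real_of_intv (R : realType) (n : nat) (w : 'rV[int]_n) : 'rV[R]_n :=
  map_mx intr w.

Definition line_image (R : realType) (n : nat) (w : 'rV[int]_n) :
    set (torus R n) :=
  [set to_torus (t *: real_of_intv R w) | t in [set: R]].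

Definition plane_image (R : realType) (n : nat) (u v : 'rV[int]_n) :
    set (torus R n) :=
  [set to_torus (s *: real_of_intv R u + t *: real_of_intv R v)
     | s in [set: R] & t in [set: R]].

Arguments line_image R {n} w.
Arguments plane_image R {n} u v.

Definition one_dim_subtorus (R : realType) (n : nat)
    (U T : set (torus R n)) : Prop :=
  (exists2 w : 'rV[int]_n, w != 0 & T = line_image R w) /\ T `<=` U.

Definition generators := ('rV[int]_6 * 'rV[int]_6)%type.

Definition e6 : 'rV[int]_6 := \row_(i < 6) [:: 0; 0; 0; 0; 0; 1]`_i.

Definition gensA : generators := (\row_(i < 6) [:: 1; 2; 3; 4; 5; 0]`_i, e6).

Definition gensB : generators := (\row_(i < 6) [:: 1; 3; 4; 5; 9; 0]`_i, e6).

Definition gensC : generators :=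
  (\row_(i < 6) [:: 1; 0; 1; 2; 3; 3]`_i,
   \row_(i < 6) [:: 0; 1; 1; 1; 1; 2]`_i).

Definition plane (R : realType) (g : generators) : set (torus R 6) :=
  plane_image R g.1 g.2.

Arguments plane : clear implicits.

Definition speed_vector (g : generators) (A B : int) : 'rV[int]_6 :=
  A *: g.1 + B *: g.2.

Definition parameters (R : realType) (g : generators) (T : set (torus R 6))
    (A B : int) : Prop :=
  coprimez A B /\ T = line_image R (speed_vector g A B).

(* As [parameters] determines [(A, B)] up to a common sign, this and
   [max_speed] depend on [T] only. *)
Definition distinct_nonzero_speeds (v : 'rV[int]_6) : Prop :=
  (forall i, v ord0 i != 0) /\
  (forall i j, i != j -> `|v ord0 i| != `|v ord0 j|).

Definition max_speed (v : 'rV[int]_6) : nat := (\max_(i < 6) `|v ord0 i|)%N.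

Definition small_ML_subtorus (R : realType) (g : generators)
    (T : set (torus R 6)) (A B : int) : Prop :=
  [/\ one_dim_subtorus (plane R g) T, parameters g T A B,
      distinct_nonzero_speeds (speed_vector g A B) & ML T < 1 / 6].

Definition k3_case (A B : int) : Prop :=
  [\/ (A = 0 %[mod 6])%Z /\ (B = 5 %[mod 6])%Z /\ 0 < A + 2 * B,
      (A = 0 %[mod 6])%Z /\ (B = 1 %[mod 6])%Z /\ 5 * A + 2 * B < 0,
      (A = 5 %[mod 6])%Z /\ (B = 1 %[mod 6])%Z /\
        0 < 5 * A + 3 * B /\ 0 < A - B |
      (A = 5 %[mod 6])%Z /\ (B = 2 %[mod 6])%Z /\
        0 < 4 * A + B /\ 4 * A + 3 * B < 0].

(* Main.v *)
Require Import Defs.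
From HB Require Import structures.
From mathcomp Require Import all_boot all_order all_algebra.
From mathcomp Require Import all_classical all_reals.
From mathcomp Require Import zify ring lra.

Set Implicit Arguments.
Unset Strict Implicit.
Unset Printing Implicit Defensive.

Import Order.TTheory GRing.Theory Num.Theory.

Local Open Scope classical_set_scope.
Local Open Scope ring_scope.

(** Write [(a, b)] for the point [a u + b v] of the plane. The subtorus with
    coprime parameters [(A, B)] consists of the points with [B a - A b] an
    integer ([reaches_time]), so [ML T] is the largest [d] such that one of
    these parallel lines meets the set [far] where all six norms are at least
    [d] ([ML_max]).

    In the third plane the six linear forms [a, b, a + b, 2 a + b, 3 a + b,
    3 a + 2 b] are the positive roots of the root system G2. Their integral
    level lines cut the torus into twelve triangles (alcoves), and in each of
    them the smallest norm is the smallest of the three wall distances. In the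
    alcove [a, b >= 0, 3 a + 2 b <= 1] it has the single maximum [1 / 6], at
    [a = b = 1 / 6], and the region where it exceeds [1 / 6 - h] is a triangle
    around that centre, scaled by [h]. A line of [T] through no centre stays at
    a distance from the centre that is controlled by [A - B] modulo 6, and the
    first [h] at which the triangle meets the line is a quotient of a linear
    form in [(A, B)], depending only on the corner touched, by an integer [e]
    congruent to [A - B] modulo 6. The other alcoves are carried onto this one,
    which replaces [(A, B)] by another pair of the same kind. Hence
    [ML T = 1 / 6 - 1 / (6 P)], where [P] is the largest of these quotients over
    all alcoves ([alcove_bound], [reaches_le], [reaches_corner]).

    The Weyl group of G2 permutes the six forms up to sign and acts both on the
    alcoves and on [(A, B)], so that [A, B > 0] may be assumed
    ([dominant_rep]). If no centre lies on [T], then [(A, B)] falls in one of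
    twelve classes modulo 6, and in each of them the largest quotient has
    denominator [e = 1] or [-1], so that [P] is an integer linear form in
    [(A, B)] ([dominant_cases]). It is 1 modulo 6 except for [P = 2 A + B] in
    the class [(0, 5)] and, if [B < A], in the class [(5, 1)]; the four cases
    of [k = 3] are the images of these two under the Weyl group. As [3 A + 2 B]
    is then the largest speed, the bound [3 q] can be read off; it is
    approached along [(6 m + 1, 6)], where [P = A + 2 B]
    ([max_speed_ratio_sharp]).

    In the first two planes the last coordinate is free. If [|A| > 1], it can be
    placed at distance [1 / 6] from the integers while the other five are at
    their optimum; so [A = 1] up to sign, and [6] divides [B]. Then the maximum
    is [1 / 6 - 1 / (6 (|B| + 1))], attained slightly before the time [1 / 6],
    with one exception: [(1, 3, 4, 5, 9, 6)] attains [2 / 13] at the time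
    [6 / 13] ([reaches_leA], [reaches_leB]).

    Finally [(P - 1) / (6 P)] in lowest terms is [m / (6 m + 1)] if
    [P = 6 m + 1] and [(3 m + 2) / (18 m + 15)] if [P = 6 m + 5]. *)

(** * Distance to the nearest integer *)

Lemma dist_int_le (R : realType) (x : R) (m : int) :
  dist_int x <= `|x - m%:~R|.
Proof. by apply: ge_inf; [exists 0 => _ [k _ <-] | exists m]. Qed.

Lemma dist_int_ge (R : realType) (d x : R) (m : int) :
  m%:~R + d <= x -> x <= (m + 1)%:~R - d -> d <= dist_int x.
Proof.
rewrite intrD => dx xd; apply: lb_le_inf; first by exists `|x - 0%:~R|, 0.
move=> _ [k _ <-]; have [km|mk] := lerP k m.
  have : k%:~R <= m%:~R :> R by rewrite ler_int.
  by move=> ?; apply: le_trans (ler_norm _); lra.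
have : (m + 1)%:~R <= k%:~R :> R by rewrite ler_int; lia.
by rewrite intrD distrC => ?; apply: le_trans (ler_norm _); lra.
Qed.

Lemma le_dist_int (R : realType) (d x : R) (m : int) :
  d <= dist_int x -> d <= `|x - m%:~R|.
Proof. by move/le_trans; apply; apply: dist_int_le. Qed.

Lemma dist_int_above (R : realType) (d x y : R) (m : int) :
  d <= dist_int x -> 0 <= y -> x - m%:~R = y -> d <= y.
Proof.
by move=> dx y0 xE; have := le_dist_int m dx; rewrite xE ger0_norm.
Qed.

Lemma dist_int_below (R : realType) (d x y : R) (m : int) :
  d <= dist_int x -> 0 <= y -> m%:~R - x = y -> d <= y.
Proof.
by move=> dx y0 xE; have := le_dist_int m dx; rewrite distrC xE ger0_norm.
Qed.

Lemma dist_intD (R : realType) (x : R) (m : int) :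
  dist_int (x + m%:~R) = dist_int x.
Proof.
rewrite -!normTE; congr normT.
by apply/to_RmodZP; exists m; rewrite addrC addKr.
Qed.

Lemma dist_intN (R : realType) (x : R) : dist_int (- x) = dist_int x.
Proof.
have le_N y : dist_int (- y) <= dist_int y :> R.
  apply: lb_le_inf; first by exists `|y - 0%:~R|, 0.
  move=> _ [k _ <-]; rewrite -normrN opprB addrC -[k]opprK intrN.
  exact: dist_int_le.
by apply/eqP; rewrite eq_le le_N -{1}[x]opprK le_N.
Qed.

(** * The maximal loneliness of a line in a plane *)

Definition far (R : realType) (g : generators) (d a b : R) : Prop :=
  forall i, d <= dist_int ((g.1 ord0 i)%:~R * a + (g.2 ord0 i)%:~R * b).

(** Stated on the preimage of the subtorus in the plane, and not with a time
    [t], because this form makes sense for all integers [A], [B] and is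
    compatible with linear changes of [(A, B)]. *)
Definition reaches (R : realType) (g : generators) (A B : int) (d : R) : Prop :=
  exists a b (n : int), B%:~R * a - A%:~R * b = n%:~R /\ far g d a b.

Lemma far_shift (R : realType) g (d a b : R) (m n : int) :
  far g d a b -> far g d (a + m%:~R) (b + n%:~R).
Proof.
move=> f i; set u := g.1 _ _; set v := g.2 _ _.
have -> : u%:~R * (a + m%:~R) + v%:~R * (b + n%:~R) =
          (u%:~R * a + v%:~R * b) + (u * m + v * n)%:~R :> R by ring.
by rewrite dist_intD; apply: f.
Qed.

Lemma far_opp (R : realType) g (d a b : R) : far g d a b -> far g d (- a) (- b).
Proof. by move=> f i; rewrite !mulrN -opprD dist_intN; apply: f. Qed.

Lemma reaches_opp (R : realType) g A B (d : R) :
  reaches g A B d -> reaches g (- A) (- B) d.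
Proof.
move=> [a] [b] [n] [line f]; exists a, b, (- n); split=> //.
by rewrite !intrN -line; ring.
Qed.

(** A Bezout relation [u A + v B = 1] provides the time [u a + v b], at which
    the line is, modulo 1, at the point of coordinates [(a, b)]. *)
Lemma reaches_time (R : realType) g A B (d : R) : coprimez A B ->
  reaches g A B d <-> exists t, far g d (t * A%:~R) (t * B%:~R).
Proof.
move=> /coprimezP[[u v] /= uv]; split=> [|[t f]]; last first.
  by exists (t * A%:~R), (t * B%:~R), 0; split=> //; ring.
move=> [a] [b] [n] [line f]; exists (u%:~R * a + v%:~R * b).
have unit x : x = (u%:~R * A%:~R + v%:~R * B%:~R) * x :> R.
  by rewrite -!intrM -intrD uv mul1r.
have -> : (u%:~R * a + v%:~R * b) * A%:~R = a + (- v * n)%:~R :> R.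
  rewrite intrM intrN -line [X in _ = X + _]unit; ring.
have -> : (u%:~R * a + v%:~R * b) * B%:~R = b + (u * n)%:~R :> R.
  rewrite intrM -line [X in _ = X + _]unit; ring.
exact: far_shift.
Qed.

Lemma min_norm_line (R : realType) g A B (d t : R) :
  d <= min_norm (to_torus (t *: real_of_intv R (speed_vector g A B))) <->
  far g d (t * A%:~R) (t * B%:~R).
Proof.
have normE i : normT ((to_torus (t *: real_of_intv R (speed_vector g A B)))
    ord0 i) = dist_int ((g.1 ord0 i)%:~R * (t * A%:~R) +
                        (g.2 ord0 i)%:~R * (t * B%:~R)).
  by rewrite !mxE normTE intrD !intrM; congr dist_int; ring.
split=> [/bigmin_geP[_ f] i|f]; first by rewrite -normE; apply: f.
by apply/bigmin_geP; split=> [|i _]; rewrite normE; apply: f.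
Qed.

Lemma ML_max (R : realType) g A B (d : R) : coprimez A B ->
  reaches g A B d -> (forall d', reaches g A B d' -> d' <= d) ->
  ML (line_image R (speed_vector g A B)) = d.
Proof.
move=> coAB /(reaches_time _ _ coAB)[t /min_norm_line le_d] max_d.
have ub : ubound [set min_norm x | x in line_image R (speed_vector g A B)] d.
  move=> _ [_ [s _ <-] <-]; apply: max_d; apply/(reaches_time _ _ coAB).
  by exists s; apply/min_norm_line.
apply/eqP; rewrite eq_le; apply/andP; split.
  by apply: ge_sup ub; eexists; eexists; [exists t | ].
apply: le_trans le_d _; apply: ub_le_sup; first by exists d.
by eexists; [exists t | ].
Qed.

Lemma ML_ge (R : realType) g A B (d : R) : coprimez A B ->
  reaches g A B d -> d <= ML (line_image R (speed_vector g A B)).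
Proof.
move=> coAB /(reaches_time _ _ coAB)[t /min_norm_line le_d].
apply: le_trans le_d _; apply: ub_le_sup; last by eexists; [exists t | ].
exists 1 => _ [x _ <-]; apply: le_trans (bigmin_le_id _ _ _ _) _.
set y := repr (x ord0 ord0); rewrite /normT -/y.
apply: le_trans (dist_int_le y (Num.floor y)) _.
have /andP[fl_le lt_fl] := floor_itv y; rewrite intrD in lt_fl.
by rewrite ger0_norm; lra.
Qed.

(** * The root system behind the third plane *)

Lemma far6 (R : realType) (g : generators) (d a b x0 x1 x2 x3 x4 x5 : R) :
  (forall i, (g.1 ord0 i)%:~R * a + (g.2 ord0 i)%:~R * b =
             [:: x0; x1; x2; x3; x4; x5]`_i) ->
  far g d a b <->
  [/\ [/\ d <= dist_int x0, d <= dist_int x1 & d <= dist_int x2],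
      d <= dist_int x3, d <= dist_int x4 & d <= dist_int x5].
Proof.
move=> E; split=> [f|[[]]].
  by do !split; [move: (f (inord 0)) | move: (f (inord 1)) |
    move: (f (inord 2)) | move: (f (inord 3)) | move: (f (inord 4)) |
    move: (f (inord 5))]; rewrite E inordK.
by move=> *; rewrite /far => i; rewrite E; case: i => [[|[|[|[|[|[|]]]]]]] /=.
Qed.

Lemma farC (R : realType) (d a b : R) :
  far gensC d a b <->
  [/\ [/\ d <= dist_int a, d <= dist_int b & d <= dist_int (a + b)],
      d <= dist_int (2 * a + b), d <= dist_int (3 * a + b) &
      d <= dist_int (3 * a + 2 * b)].
Proof.
by apply: far6 => i; rewrite !mxE;
  case: i => [[|[|[|[|[|[|]]]]]]] //= _; ring.
Qed.

(** The reflections [far_reflect_short] and [far_reflect_long] in the simple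
    roots [a] and [b] permute the six forms up to sign, and generate the Weyl
    group. *)
Lemma far_reflect_short (R : realType) (d a b : R) :
  far gensC d a b -> far gensC d (- a) (3 * a + b).
Proof.
move=> /farC[[fa fb fab] f2 f3 f32]; apply/farC; rewrite dist_intN.
by do !split => //; [move: f2 | move: fab | move: fb | move: f32];
  congr (_ <= dist_int _); ring.
Qed.

Lemma far_reflect_long (R : realType) (d a b : R) :
  far gensC d a b -> far gensC d (a + b) (- b).
Proof.
move=> /farC[[fa fb fab] f2 f3 f32]; apply/farC; rewrite dist_intN.
by do !split => //; [move: fa | move: f2 | move: f32 | move: f3];
  congr (_ <= dist_int _); ring.
Qed.

Lemma reaches_reflect_short (R : realType) (A B : int) (d : R) :
  reaches gensC A B d -> reaches gensC (- A) (3 * A + B) d.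
Proof.
move=> [a] [b] [n] [line f]; exists (- a), (3 * a + b), (- n).
by split; [rewrite [RHS]intrN -line; ring | apply: far_reflect_short].
Qed.

Lemma reaches_reflect_long (R : realType) (A B : int) (d : R) :
  reaches gensC A B d -> reaches gensC (A + B) (- B) d.
Proof.
move=> [a] [b] [n] [line f]; exists (a + b), (- b), (- n).
by split; [rewrite [RHS]intrN -line; ring | apply: far_reflect_long].
Qed.

(** The Weyl group has order twelve and contains [- 1]; these are the images of
    [(A, B)] up to sign. As linear forms, each pair is a base of the root
    system; the sign is the one that makes its short root positive. *)
Definition weyl (A B : int) : seq (int * int) :=
  [:: (A, B); (A, - (3 * A + B)); (A + B, - B); (A + B, - (3 * A + 2 * B));
      (2 * A + B, - (3 * A + B)); (2 * A + B, - (3 * A + 2 * B))].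

Lemma weyl_ind (A B : int) (Q : int -> int -> Prop) :
  Q A B -> Q A (- (3 * A + B)) -> Q (A + B) (- B) ->
  Q (A + B) (- (3 * A + 2 * B)) -> Q (2 * A + B) (- (3 * A + B)) ->
  Q (2 * A + B) (- (3 * A + 2 * B)) ->
  forall p, p \in weyl A B -> Q p.1 p.2.
Proof.
by move=> Q1 Q2 Q3 Q4 Q5 Q6 p; rewrite !inE => /or4P[|||/or3P[]] /eqP ->.
Qed.

Lemma reaches_weyl (R : realType) (A B : int) (d : R) p : p \in weyl A B ->
  reaches gensC p.1 p.2 d <-> reaches gensC A B d.
Proof.
set S := @reaches_reflect_short R; set L := @reaches_reflect_long R.
have N := @reaches_opp R gensC.
have eqr A' B' X Y : reaches gensC X Y d -> X = A' -> Y = B' ->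
  reaches gensC A' B' d by move=> + <- <-.
move: p; apply: (weyl_ind (Q := fun X Y =>
  reaches gensC X Y d <-> reaches gensC A B d)) => //; split=> H.
- by apply: (eqr _ _ _ _ (S _ _ _ (N _ _ _ H))); lia.
- by apply: (eqr _ _ _ _ (N _ _ _ (S _ _ _ H))); lia.
- by apply: (eqr _ _ _ _ (L _ _ _ H)); lia.
- by apply: (eqr _ _ _ _ (L _ _ _ H)); lia.
- by apply: (eqr _ _ _ _ (L _ _ _ (S _ _ _ (N _ _ _ H)))); lia.
- by apply: (eqr _ _ _ _ (N _ _ _ (S _ _ _ (L _ _ _ H)))); lia.
- by apply: (eqr _ _ _ _ (S _ _ _ (L _ _ _ H))); lia.
- by apply: (eqr _ _ _ _ (L _ _ _ (S _ _ _ H))); lia.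
- by apply: (eqr _ _ _ _ (S _ _ _ (L _ _ _ (S _ _ _ (N _ _ _ H))))); lia.
- by apply: (eqr _ _ _ _ (N _ _ _ (S _ _ _ (L _ _ _ (S _ _ _ H))))); lia.
Qed.

(** * Upper bound in each alcove *)

(** This keeps the lines of parameters [(A, B)] away from the points of the
    alcove [a, b >= 0, 3 a + 2 b <= 1] whose three wall distances exceed
    [1 / 6 - h], where [h = 1 / (6 P)]. With [a = 1 / 6 + x] and
    [b = 1 / 6 + y], these points form the triangle with corners [(- h, - h)],
    [(h, - h)], [(- h, 2 h)], and the condition [B a - A b = n] reads
    [B x - A y = e / 6] with [e = 6 n + A - B]. The three linear forms below
    are the values of [(B x - A y) / h] at the corners, and [e / (6 h)] must
    not lie strictly between the least and the greatest of them. *)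
Definition barrier (A B P : int) : Prop := forall e, (e = A - B %[mod 6])%Z ->
  (0 < e /\ [/\ A - B <= e * P, A + B <= e * P & - (2 * A + B) <= e * P]) \/
  (e < 0 /\ [/\ e * P <= A - B, e * P <= A + B & e * P <= - (2 * A + B)]).

(** A point of a triangle is the barycentre of the corners, so a linear function
    takes there no value beyond those it takes at the corners. *)
Lemma alcove_bound (R : realType) (A B P n : int) (d a b : R) :
  barrier A B P -> B%:~R * a - A%:~R * b = n%:~R ->
  d <= a -> d <= b -> d <= 1 - 3 * a - 2 * b -> 1 <= (1 - 6 * d) * P%:~R.
Proof.
move=> bar line da db dab; have := bar (6 * n + A - B).
set e : int := 6 * n + A - B.
have eE : B%:~R * (6 * a - 1) - A%:~R * (6 * b - 1) = e%:~R :> R.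
  by rewrite /e !rmorphB rmorphD rmorphM /= -line; ring.
(* the case of a negative [e] is that of [(- A, - B)] *)
have pos (A' B' e' : int) : 0 < e' ->
    A' - B' <= e' * P -> A' + B' <= e' * P -> - (2 * A' + B') <= e' * P ->
    B'%:~R * (6 * a - 1) - A'%:~R * (6 * b - 1) = e'%:~R :> R ->
    1 <= (1 - 6 * d) * P%:~R.
  rewrite -(ltr_int R) -3!(ler_int R) => e0 c1 c2 c3 eE'.
  move: c1 c2 c3; rewrite !(intrB, intrD, intrN, intrM) => c1 c2 c3.
  (* the first factors are, up to scale, the barycentric coordinates of the
     point in the triangle where all wall distances are at least [d] *)
  have k1 : 0 <= (1 - 3 * a - 2 * b - d) *
      (e'%:~R * P%:~R - (A'%:~R - B'%:~R)) by apply: mulr_ge0; lra.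
  have k2 : 0 <= (a - d) * (e'%:~R * P%:~R - (A'%:~R + B'%:~R)).
    by apply: mulr_ge0; lra.
  have k3 : 0 <= (b - d) * (e'%:~R * P%:~R + (2 * A'%:~R + B'%:~R)).
    by apply: mulr_ge0; lra.
  suff : 0 <= e'%:~R * ((1 - 6 * d) * P%:~R - 1) by rewrite pmulr_rge0//; lra.
  rewrite mulrBr mulr1 -{2}eE'.
  have -> : e'%:~R * ((1 - 6 * d) * P%:~R) -
      (B'%:~R * (6 * a - 1) - A'%:~R * (6 * b - 1)) =
      (1 - 3 * a - 2 * b - d) * (e'%:~R * P%:~R - (A'%:~R - B'%:~R)) +
      (a - d) * (e'%:~R * P%:~R - (A'%:~R + B'%:~R)) *+ 3 +
      (b - d) * (e'%:~R * P%:~R + (2 * A'%:~R + B'%:~R)) *+ 2 by ring.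
  by rewrite !addr_ge0 ?mulrn_wge0.
have eN : - e%:~R = (- e)%:~R :> R by rewrite intrN.
case=> [|[e0 [c1 c2 c3]]|[e0 [c1 c2 c3]]]; first by rewrite /e; lia.
  exact: (pos A B e).
apply: (pos (- A) (- B) (- e)); [lia | lia | lia | lia | ].
by rewrite !intrN -eE; ring.
Qed.

(** A translation and [(a, b) -> (- a, - b)] bring the point into the half
    square [a, b >= 0, a + b <= 1], which is the union of six alcoves. Each of
    them is carried onto the alcove [a, b >= 0, 3 a + 2 b <= 1] by an affine
    map whose linear part turns [(A, B)] into a member of [weyl A B], up to
    sign; the new coordinates are two of the three wall distances. *)
Lemma reaches_le (R : realType) (A B P : int) (d : R) :
  (forall p, p \in weyl A B -> barrier p.1 p.2 P) ->
  reaches gensC A B d -> 1 <= (1 - 6 * d) * P%:~R.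
Proof.
move=> bar [a] [b] [n] [line f].
(* one half of the unit square suffices, by [(a, b) -> (1 - a, 1 - b)] *)
have [a' [b' [n' [{}line {}f [a0 b0 ab]]]]] : exists a' b' (n' : int),
    [/\ B%:~R * a' - A%:~R * b' = n'%:~R, far gensC d a' b' &
        [/\ 0 <= a', 0 <= b' & a' + b' <= 1]].
  have /andP[a0 a1] := floor_itv a; have /andP[b0 b1] := floor_itv b.
  move: a1 b1; set i := Num.floor a; set j := Num.floor b.
  rewrite !intrD => a1 b1.
  have {}line : B%:~R * (a + (- i)%:~R) - A%:~R * (b + (- j)%:~R) =
      (n - B * i + A * j)%:~R :> R by rewrite !(intrD, intrN, intrM) -line; ring.
  have {}f := far_shift (- i) (- j) f.
  have [ab|ab] := lerP ((a + (- i)%:~R) + (b + (- j)%:~R)) 1.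
    by exists (a + (- i)%:~R), (b + (- j)%:~R), (n - B * i + A * j);
       split=> //; split; rewrite // intrN; lra.
  exists (- (a + (- i)%:~R) + 1%:~R), (- (b + (- j)%:~R) + 1%:~R),
         (B - A - (n - B * i + A * j)); split.
  - by rewrite intrB -line; ring.
  - by apply/far_shift/far_opp.
  - by split; move: ab; rewrite !intrN; lra.
move: f => /farC[[fa fb fab] f2 f3 f32].
have [c32|c32] := lerP (3 * a' + 2 * b') 1.
  apply: (alcove_bound (bar (A, B) _) line); rewrite ?inE ?eqxx //.
  - by apply: (@dist_int_above _ _ a' _ 0); first [done|lra|ring].
  - by apply: (@dist_int_above _ _ b' _ 0); first [done|lra|ring].
  - by apply: (@dist_int_below _ _ (3 * a' + 2 * b') _ 1); first [done|lra|ring].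
have [c31|c31] := lerP (3 * a' + b') 1.
  apply: (@alcove_bound _ _ _ _ (- n' - A) _ a' (1 - 3 * a' - b')
           (bar (A, - (3 * A + B)) _)); rewrite ?inE ?eqxx ?orbT //=.
  - by rewrite !(intrD, intrN, intrM) -line; ring.
  - by apply: (@dist_int_above _ _ a' _ 0); first [done|lra|ring].
  - by apply: (@dist_int_below _ _ (3 * a' + b') _ 1); first [done|lra|ring].
  - by apply: (@dist_int_above _ _ (3 * a' + 2 * b') _ 1); first [done|lra|ring].
have [c21|c21] := lerP (2 * a' + b') 1.
  apply: (@alcove_bound _ _ _ _ (- n' - A) _ (1 - 2 * a' - b')
           (3 * a' + b' - 1) (bar (2 * A + B, - (3 * A + B)) _));
    rewrite ?inE ?eqxx ?orbT //=.
  - by rewrite !(intrD, intrN, intrM) -line; ring.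
  - by apply: (@dist_int_below _ _ (2 * a' + b') _ 1); first [done|lra|ring].
  - by apply: (@dist_int_above _ _ (3 * a' + b') _ 1); first [done|lra|ring].
  - by apply: (@dist_int_above _ _ b' _ 0); first [done|lra|ring].
have [c32'|c32'] := lerP (3 * a' + 2 * b') 2.
  apply: (@alcove_bound _ _ _ _ (- n' - A) _ (2 * a' + b' - 1)
           (2 - 3 * a' - 2 * b') (bar (2 * A + B, - (3 * A + 2 * B)) _));
    rewrite ?inE ?eqxx ?orbT //=.
  - by rewrite !(intrD, intrN, intrM) -line; ring.
  - by apply: (@dist_int_above _ _ (2 * a' + b') _ 1); first [done|lra|ring].
  - by apply: (@dist_int_below _ _ (3 * a' + 2 * b') _ 2); first [done|lra|ring].
  - by apply: (@dist_int_above _ _ b' _ 0); first [done|lra|ring].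
have [c31'|c31'] := lerP (3 * a' + b') 2.
  apply: (@alcove_bound _ _ _ _ (- n' - A) _ (1 - a' - b')
           (3 * a' + 2 * b' - 2) (bar (A + B, - (3 * A + 2 * B)) _));
    rewrite ?inE ?eqxx ?orbT //=.
  - by rewrite !(intrD, intrN, intrM) -line; ring.
  - by apply: (@dist_int_below _ _ (a' + b') _ 1); first [done|lra|ring].
  - by apply: (@dist_int_above _ _ (3 * a' + 2 * b') _ 2); first [done|lra|ring].
  - by apply: (@dist_int_below _ _ (3 * a' + b') _ 2); first [done|lra|ring].
apply: (@alcove_bound _ _ _ _ (n' - B) _ (1 - a' - b') b'
         (bar (A + B, - B) _)); rewrite ?inE ?eqxx ?orbT //=.
- by rewrite !(intrD, intrN, intrM) -line; ring.
- by apply: (@dist_int_below _ _ (a' + b') _ 1); first [done|lra|ring].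
- by apply: (@dist_int_above _ _ b' _ 0); first [done|lra|ring].
- by apply: (@dist_int_above _ _ (3 * a' + b') _ 2); first [done|lra|ring].
Qed.

(** * Points where the bound is attained *)

Lemma far_alcove (R : realType) (d a b : R) : 0 <= d ->
  d <= a -> d <= b -> 3 * a + 2 * b <= 1 - d -> far gensC d a b.
Proof.
move=> d0 da db dab; apply/farC.
by do !split; apply: (@dist_int_ge _ _ _ 0); lra.
Qed.

(** The line passes through the centre [(1 / 6, 1 / 6)] of the alcove. *)
Lemma reaches_centre (R : realType) (A B : int) p : p \in weyl A B ->
  (p.1 = p.2 %[mod 6])%Z -> reaches gensC A B (1 / 6 : R).
Proof.
move=> pW pE; apply/(reaches_weyl _ pW); set A' := p.1 in pE *.
exists (1 / 6), (1 / 6), ((p.2 - A') %/ 6)%Z; split; last by apply: far_alcove; lra.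
have : p.2 - A' = 6 * ((p.2 - A') %/ 6)%Z by lia.
set n := (_ %/ _)%Z => /(congr1 (intr : int -> R)); rewrite intrB intrM; lra.
Qed.

(** With [h = 1 / (6 P)], the line passes through the corner [(- h, - h)] of the
    triangle around the centre in the first case, and through [(h, - h)] in
    the second: there [B x - A y] is [(A - B) h = 1 / 6], respectively
    [(A + B) h = - 1 / 6], and the residue of [A - B] makes [B a - A b]
    an integer. *)
Lemma reaches_corner (R : realType) (A B P : int) p : p \in weyl A B -> 0 < P ->
  (p.1 - p.2 = 1 %[mod 6])%Z /\ p.1 - p.2 = P \/
  (p.1 - p.2 = -1 %[mod 6])%Z /\ p.1 + p.2 = - P ->
  reaches gensC A B ((P - 1)%:~R / (6 * P)%:~R : R).
Proof.
move=> pW P0 pP; apply/(reaches_weyl _ pW).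
have P1 : 1 <= P%:~R :> R by rewrite (ler_int R 1); lia.
set h : R := (6 * P%:~R)^-1.
have Ph : 6 * (P%:~R * h) = 1 by rewrite mulrA divff //; apply/eqP; lra.
have h0 : 0 < h by rewrite invr_gt0; lra.
have h1 : h <= 1 / 6.
  have : 0 <= (P%:~R - 1) * h by apply: mulr_ge0; lra.
  by rewrite mulrBl; lra.
have -> : (P - 1)%:~R / (6 * P)%:~R = 1 / 6 - h :> R.
  rewrite intrB intrM -/h mulrBl mul1r; lra.
have line (n x y : int) : x = 6 * n + y -> x%:~R = 6 * n%:~R + y%:~R :> R.
  by move=> ->; rewrite intrD intrM.
case: pP => -[pE pP].
  exists (1 / 6 - h), (1 / 6 - h), ((p.2 - p.1 + 1) %/ 6)%Z.
  split; last by apply: far_alcove; lra.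
  have /line : p.2 = 6 * ((p.2 - p.1 + 1) %/ 6)%Z + (p.1 - 1) by lia.
  rewrite intrB => E.
  have -> : p.2%:~R * (1 / 6 - h) - p.1%:~R * (1 / 6 - h) =
    (p.2%:~R - p.1%:~R) / 6 + (p.1 - p.2)%:~R * h :> R by rewrite intrB; field.
  by rewrite pP; lra.
exists (1 / 6 + h), (1 / 6 - h), ((p.2 - p.1 - 1) %/ 6)%Z.
split; last by apply: far_alcove; lra.
have /line : p.2 = 6 * ((p.2 - p.1 - 1) %/ 6)%Z + (p.1 + 1) by lia.
rewrite intrD => E.
have -> : p.2%:~R * (1 / 6 + h) - p.1%:~R * (1 / 6 - h) =
  (p.2%:~R - p.1%:~R) / 6 + (p.1 + p.2)%:~R * h :> R by rewrite intrD; field.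
by rewrite pP intrN; lra.
Qed.

(** Of the integers [e] congruent to [d], only [d] and [d - 6] matter: they
    are the ones of each sign that are closest to zero. *)
Lemma barrier_of_residue (A B P d : int) : 0 < d < 6 -> 0 <= P ->
  (A - B = d %[mod 6])%Z ->
  [/\ A - B <= d * P, A + B <= d * P & - (2 * A + B) <= d * P] ->
  [/\ B - A <= (6 - d) * P, - (A + B) <= (6 - d) * P &
      2 * A + B <= (6 - d) * P] ->
  barrier A B P.
Proof.
move=> d6 P0 Ed [c1 c2 c3] [c4 c5 c6] e; rewrite Ed => Ee.
have [e0|e0] : d <= e \/ e <= - (6 - d) by lia.
  have eP : d * P <= e * P by rewrite ler_wpM2r.
  by left; split; [lia | split; lia].
have eP : e * P <= - (6 - d) * P by rewrite ler_wpM2r.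
by right; split; [lia | split; lia].
Qed.

(** * The dominant chamber *)

(** The pairs [A, B > 0] with [P = 2 A + B = 5] modulo 6. *)
Definition k3_dominant (A B : int) : Prop :=
  (A = 0 %[mod 6])%Z /\ (B = 5 %[mod 6])%Z \/
  (A = 5 %[mod 6])%Z /\ (B = 1 %[mod 6])%Z /\ B < A.

(** The value [(P - 1) / (6 P)] is attained at a corner in one alcove, and is not
    exceeded in any alcove. *)
Definition exact_denominator (A B P : int) : Prop :=
  (exists2 p, p \in weyl A B &
     (p.1 - p.2 = 1 %[mod 6])%Z /\ p.1 - p.2 = P \/
     (p.1 - p.2 = -1 %[mod 6])%Z /\ p.1 + p.2 = - P) /\
  (forall p, p \in weyl A B -> barrier p.1 p.2 P).

Ltac barrier_by d := apply: (@barrier_of_residue _ _ _ d);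
  solve [done | lia | split; lia].

Ltac barrier_tac := first
  [barrier_by (1 : int) | barrier_by (2 : int) | barrier_by (3 : int) |
   barrier_by (4 : int) | barrier_by (5 : int)].

Ltac exact_denominator_at p :=
  split; [exists p; [by rewrite !inE eqxx ?orbT | rewrite /=; lia] |
          apply: (weyl_ind (Q := fun X Y => barrier X Y _)); barrier_tac].

(** Each of the twelve classes modulo 6 that are left comes with the
    Weyl image for which [e = 1], or [e = - 1], gives the largest quotient;
    since [A, B > 0], the comparisons with the other quotients are linear. Only
    the class [(5, 1)] has two candidates, [A + 2 B] and [2 A + B]. *)
Lemma dominant_cases (A B : int) : 0 < A -> 0 < B ->
  ~ ((A = 0 %[mod 2])%Z /\ (B = 0 %[mod 2])%Z) ->
  (exists2 p, p \in weyl A B & (p.1 = p.2 %[mod 6])%Z) \/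
  exists P, [/\ 0 < P, exact_denominator A B P &
    (P = 1 %[mod 6])%Z /\ ~ k3_dominant A B /\ 3 * A + 2 * B < 3 * P \/
    (P = 5 %[mod 6])%Z /\ k3_dominant A B /\ 3 * A + 2 * B < 9 * P].
Proof.
move=> A0 B0 AB2.
have [/hasP[p pW /eqP pE]|/hasPn no_centre] :=
  boolP (has (fun p => (p.1 %% 6)%Z == (p.2 %% 6)%Z) (weyl A B)).
  by left; exists p.
right.
have no p : p \in weyl A B -> (p.1 %% 6)%Z <> (p.2 %% 6)%Z.
  by move=> /no_centre/eqP.
have := (no (A, B), no (A, - (3 * A + B)), no (A + B, - B),
  no (A + B, - (3 * A + 2 * B)), no (2 * A + B, - (3 * A + B)),
  no (2 * A + B, - (3 * A + 2 * B))).
rewrite !inE !eqxx ?orbT /= => -[[[[[]]]]].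
move=> /(_ isT) n1 /(_ isT) n2 /(_ isT) n3 /(_ isT) n4 /(_ isT) n5 /(_ isT) n6.
clear no no_centre.
have rA : (A %% 6)%Z \in [:: 0; 1; 2; 3; 4; 5] by rewrite !inE; lia.
have rB : (B %% 6)%Z \in [:: 0; 1; 2; 3; 4; 5] by rewrite !inE; lia.
rewrite /k3_dominant.
(* twelve of the 36 classes satisfy the six conditions and are not even *)
move: rA rB; rewrite !inE => /or4P[|||/or3P[]] /eqP rA /or4P[|||/or3P[]] /eqP rB;
  try lia.
all: clear n1 n2 n3 n4 n5 n6 AB2.
- exists (4 * A + B); split;
    [lia | exact_denominator_at (A, - (3 * A + B)) | lia].
- exists (2 * A + B); split;
    [lia | exact_denominator_at (A, - (3 * A + B)) | lia].
- exists (A + 2 * B); split;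
    [lia | exact_denominator_at (A + B, - B) | lia].
- exists (4 * A + 3 * B); split;
    [lia | exact_denominator_at (A + B, - (3 * A + 2 * B)) | lia].
- exists (5 * A + 2 * B); split;
    [lia | exact_denominator_at (2 * A + B, - (3 * A + B)) | lia].
- exists (4 * A + 3 * B); split;
    [lia | exact_denominator_at (A + B, - (3 * A + 2 * B)) | lia].
- exists (5 * A + 3 * B); split;
    [lia | exact_denominator_at (2 * A + B, - (3 * A + 2 * B)) | lia].
- exists (4 * A + 3 * B); split;
    [lia | exact_denominator_at (A + B, - (3 * A + 2 * B)) | lia].
- exists (5 * A + 3 * B); split;
    [lia | exact_denominator_at (2 * A + B, - (3 * A + 2 * B)) | lia].
- have [AB|AB] := lerP A B.
    exists (A + 2 * B); split;
      [lia | exact_denominator_at (A + B, - B) | lia].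
  exists (2 * A + B); split;
    [lia | exact_denominator_at (A + B, - (3 * A + 2 * B)) | lia].
- exists (5 * A + 3 * B); split;
    [lia | exact_denominator_at (2 * A + B, - (3 * A + 2 * B)) | lia].
- exists (5 * A + 2 * B); split;
    [lia | exact_denominator_at (2 * A + B, - (3 * A + B)) | lia].
Qed.

Lemma k3_caseE (A B : int) : k3_case A B <->
  ((A = 0 %[mod 6])%Z /\ (B = 5 %[mod 6])%Z /\ 0 < A + 2 * B) \/
  ((A = 0 %[mod 6])%Z /\ (B = 1 %[mod 6])%Z /\ 5 * A + 2 * B < 0) \/
  ((A = 5 %[mod 6])%Z /\ (B = 1 %[mod 6])%Z /\
      0 < 5 * A + 3 * B /\ 0 < A - B) \/
  ((A = 5 %[mod 6])%Z /\ (B = 2 %[mod 6])%Z /\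
      0 < 4 * A + B /\ 4 * A + 3 * B < 0).
Proof.
split=> [[]|[|[|[]]]] H; first [by left | by right; left |
  by right; right; left | by right; right; right |
  exact: Or41 | exact: Or42 | exact: Or43 | exact: Or44].
Qed.

Ltac k3_cases := split=> [[[? ?]|[? [? ?]]]
  |[[? [? ?]]|[[? [? ?]]|[[? [? [? ?]]]|[? [? [? ?]]]]]]].

(** The half plane [A > 0] meets six Weyl chambers, bounded by the lines where
    a speed vanishes, and each chamber has a unique Weyl image with
    [A, B > 0]. The largest speed there is the highest root [3 A + 2 B]. *)
Lemma dominant_rep (A B : int) :
  distinct_nonzero_speeds (speed_vector gensC A B) -> 0 < A ->
  exists2 p, p \in weyl A B \/ (- p.1, - p.2) \in weyl A B &
    [/\ 0 < p.1, 0 < p.2, k3_dominant p.1 p.2 <-> k3_case A B &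
      forall i, `|speed_vector gensC A B ord0 i| <= 3 * p.1 + 2 * p.2].
Proof.
move=> [nz _] A0.
have E i : speed_vector gensC A B ord0 i =
    [:: A; B; A + B; 2 * A + B; 3 * A + B; 3 * A + 2 * B]`_i.
  by rewrite !mxE; case: i => [[|[|[|[|[|[|]]]]]]] //= _; lia.
have nz_root k (k6 : (k < 6)%N) := nz (Ordinal k6).
have {nz_root} := (nz_root 1 isT, nz_root 2 isT, nz_root 3 isT, nz_root 4 isT,
  nz_root 5 isT).
rewrite !E /= => -[[[[B0 AB0] AAB0] AAAB0] AAABB0].
have bound X : `|A| <= X -> `|B| <= X -> `|A + B| <= X -> `|2 * A + B| <= X ->
    `|3 * A + B| <= X -> `|3 * A + 2 * B| <= X ->
    forall i, `|speed_vector gensC A B ord0 i| <= X.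
  by move=> ? ? ? ? ? ? i; rewrite E; case: i => [[|[|[|[|[|[|]]]]]]].
have chambers : [\/ 0 < B, - A < B /\ B < 0 | [\/ - 3 * A < 2 * B /\ B < - A,
    - 2 * A < B /\ 2 * B < - 3 * A | - 3 * A < B /\ B < - 2 * A \/ B < - 3 * A]].
  have [c0|c0] := ltrP 0 B; first by constructor 1.
  have [c1|c1] := ltrP (- A) B; first by constructor 2; lia.
  have [c2|c2] := ltrP (- 3 * A) (2 * B); first by constructor 3; constructor 1; lia.
  have [c3|c3] := ltrP (- 2 * A) B; first by constructor 3; constructor 2; lia.
  by constructor 3; constructor 3; lia.
move: {nz E B0 AB0 AAB0 AAAB0 AAABB0} chambers.
case=> [c|[c c']|[[c c']|[c c']|[[c c']|c]]].
- exists (A, B); first by [left; rewrite !inE /= ?opprK eqxx ?orbT].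
  by split=> /=; [lia | lia | rewrite k3_caseE /k3_dominant; k3_cases; lia |
     apply: bound; lia].
- exists (A + B, - B); first by [left; rewrite !inE /= ?opprK eqxx ?orbT].
  by split=> /=; [lia | lia | rewrite k3_caseE /k3_dominant; k3_cases; lia |
     apply: bound; lia].
- exists (- (A + B), 3 * A + 2 * B); first by [right; rewrite !inE /= ?opprK eqxx ?orbT].
  by split=> /=; [lia | lia | rewrite k3_caseE /k3_dominant; k3_cases; lia |
     apply: bound; lia].
- exists (2 * A + B, - (3 * A + 2 * B)); first by [left; rewrite !inE /= ?opprK eqxx ?orbT].
  by split=> /=; [lia | lia | rewrite k3_caseE /k3_dominant; k3_cases; lia |
     apply: bound; lia].
- exists (- (2 * A + B), 3 * A + B); first by [right; rewrite !inE /= ?opprK eqxx ?orbT].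
  by split=> /=; [lia | lia | rewrite k3_caseE /k3_dominant; k3_cases; lia |
     apply: bound; lia].
- exists (A, - (3 * A + B)); first by [left; rewrite !inE /= ?opprK eqxx ?orbT].
  by split=> /=; [lia | lia | rewrite k3_caseE /k3_dominant; k3_cases; lia |
     apply: bound; lia].
Qed.

(** * Reading off numerators and denominators *)

Lemma numq_denq_coprime (n d : int) : 0 < d -> coprimez n d ->
  numq (n%:~R / d%:~R) = n /\ denq (n%:~R / d%:~R) = d.
Proof.
rewrite coprimezE => d0 co; rewrite coprimeq_num // coprimeq_den //.
by rewrite gtr0_sg // mul1r gt_eqF // gtr0_norm.
Qed.

Lemma value_residue1 (P : int) : 0 < P -> (P = 1 %[mod 6])%Z ->
  6 * numq ((P - 1)%:~R / (6 * P)%:~R) = P - 1 /\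
  denq ((P - 1)%:~R / (6 * P)%:~R) = P.
Proof.
move=> P0 P1; have [n PE] : exists n, P = 6 * n + 1.
  by exists (P %/ 6)%Z; lia.
have -> : (P - 1)%:~R / (6 * P)%:~R = n%:~R / P%:~R :> rat.
  have Pn0 : P%:~R != 0 :> rat by rewrite intr_eq0; lia.
  have -> : P - 1 = 6 * n by lia.
  rewrite !intrM; field.
  exact: Pn0.
have [|-> ->] := @numq_denq_coprime n P P0; last by lia.
by apply/coprimezP; exists (- 6, 1) => /=; lia.
Qed.

Lemma value_residue5 (P : int) : 0 < P -> (P = 5 %[mod 6])%Z ->
  2 * numq ((P - 1)%:~R / (6 * P)%:~R) = P - 1 /\
  denq ((P - 1)%:~R / (6 * P)%:~R) = 3 * P.
Proof.
move=> P0 P5; have [m PE] : exists m, P = 6 * m + 5.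
  by exists (P %/ 6)%Z; lia.
have -> : (P - 1)%:~R / (6 * P)%:~R = (3 * m + 2)%:~R / (3 * P)%:~R :> rat.
  have Pn0 : P%:~R != 0 :> rat by rewrite intr_eq0; lia.
  have -> : P - 1 = 2 * (3 * m + 2) by lia.
  rewrite !intrM; field.
  exact: Pn0.
have [||-> ->] := @numq_denq_coprime (3 * m + 2) (3 * P); [lia | | lia].
by apply/coprimezP; exists (- (6 * (m + 1) + 1), m + 1) => /=; nia.
Qed.

Lemma ratr_value (R : realType) (P : int) :
  (P - 1)%:~R / (6 * P)%:~R = ratr ((P - 1)%:~R / (6 * P)%:~R) :> R.
Proof. by rewrite fmorph_div /= !rmorph_int. Qed.

(** * Subtori of the third plane *)

Lemma exact_denominator_max (R : realType) (A B P : int) : 0 < P ->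
  exact_denominator A B P ->
  reaches gensC A B ((P - 1)%:~R / (6 * P)%:~R : R) /\
  forall d : R, reaches gensC A B d -> d <= (P - 1)%:~R / (6 * P)%:~R.
Proof.
move=> P0 [[p pW pE] bar]; split=> [|d /(reaches_le bar) dP].
  exact: reaches_corner pW P0 pE.
rewrite ler_pdivlMr ?ltr0z ?pmulr_rgt0 //.
by rewrite intrM intrB; lra.
Qed.

Lemma line_image_opp (R : realType) g (A B : int) :
  line_image R (speed_vector g (- A) (- B)) = line_image R (speed_vector g A B).
Proof.
have opp A' B' : line_image R (speed_vector g (- A') (- B')) `<=`
    line_image R (speed_vector g A' B').
  move=> _ [t _ <-]; exists (- t) => //; congr to_torus.
  by apply/rowP => i; rewrite !mxE !(intrD, intrM, intrN); ring.
by apply/seteqP; split=> //; rewrite -{1}[A]opprK -{1}[B]opprK; apply: opp.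
Qed.

Lemma distinct_nonzero_speeds_opp g (A B : int) :
  distinct_nonzero_speeds (speed_vector g A B) ->
  distinct_nonzero_speeds (speed_vector g (- A) (- B)).
Proof.
have E i : speed_vector g (- A) (- B) ord0 i = - speed_vector g A B ord0 i.
  by rewrite !mxE; lia.
move=> [nz dist]; split=> [i|i j ij]; rewrite !E ?oppr_eq0 ?normrN //.
exact: dist.
Qed.

(** A Weyl image of [(A, B)] has the same reachable [d], so everything is
    computed on the dominant one; there the case of a common factor 2 has to
    be excluded, because no line in the class [(2, 0)] meets a centre. *)
Lemma MLC_pos (R : realType) (A B : int) : 0 < A -> coprimez A B ->
  distinct_nonzero_speeds (speed_vector gensC A B) ->
  ML (line_image R (speed_vector gensC A B)) < 1 / 6 ->
  exists P, [/\ 0 < P,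
    ML (line_image R (speed_vector gensC A B)) = (P - 1)%:~R / (6 * P)%:~R &
    (P = 1 %[mod 6])%Z /\ ~ k3_case A B /\
      (forall i, `|speed_vector gensC A B ord0 i| < 3 * P) \/
    (P = 5 %[mod 6])%Z /\ k3_case A B /\
      (forall i, `|speed_vector gensC A B ord0 i| < 9 * P)].
Proof.
move=> A0 coAB speeds small.
have [[A' B'] /= pW [A'0 B'0 k3 le_speed]] := dominant_rep speeds A0.
have R' (d : R) : reaches gensC A' B' d <-> reaches gensC A B d :> Prop.
  case: pW => pW; first exact: (reaches_weyl d pW).
  split=> [/reaches_opp/(reaches_weyl d pW)|/(reaches_weyl d pW)/reaches_opp] //.
  by rewrite /= !opprK.
have odd' : ~ ((A' = 0 %[mod 2])%Z /\ (B' = 0 %[mod 2])%Z).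
  have [[u v] /= uv] := coprimezP _ _ coAB.
  move=> even'; have [a [b [AE BE]]] : exists a b, A = 2 * a /\ B = 2 * b.
    exists (A %/ 2)%Z, (B %/ 2)%Z.
    by case: pW; rewrite !inE /= => /or4P[|||/or3P[]] /eqP[? ?]; lia.
  by move: uv; rewrite AE BE; nia.
have [[p pW' pE]|[P [P0 exP cases]]] :=
  dominant_cases A'0 B'0 odd'.
  have /R'/(ML_ge coAB) := reaches_centre R pW' pE.
  by rewrite leNgt small.
have [reach max] := exact_denominator_max R P0 exP.
exists P; split=> //.
  apply: (ML_max coAB); first exact/R'.
  by move=> d /R'; apply: max.
case: cases => [[P1 [/k3 nk3 le]]|[P5 [k3' le]]]; [left | right].
  by split=> //; split; [tauto | move=> i; apply: le_lt_trans (le_speed i) le].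
by split=> //; split; [tauto | move=> i; apply: le_lt_trans (le_speed i) le].
Qed.

(** * Subtori of the first two planes *)

Lemma farA (R : realType) (d a b : R) :
  far gensA d a b <->
  [/\ [/\ d <= dist_int a, d <= dist_int (2 * a) & d <= dist_int (3 * a)],
      d <= dist_int (4 * a), d <= dist_int (5 * a) & d <= dist_int b].
Proof.
by apply: far6 => i; rewrite !mxE;
  case: i => [[|[|[|[|[|[|]]]]]]] //= _; ring.
Qed.

Lemma farB (R : realType) (d a b : R) :
  far gensB d a b <->
  [/\ [/\ d <= dist_int a, d <= dist_int (3 * a) & d <= dist_int (4 * a)],
      d <= dist_int (5 * a), d <= dist_int (9 * a) & d <= dist_int b].
Proof.
by apply: far6 => i; rewrite !mxE;
  case: i => [[|[|[|[|[|[|]]]]]]] //= _; ring.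
Qed.

(** Here the last coordinate is [b] and the others depend on [a] only. *)
Definition product_plane (g : generators) : Prop := g = gensA \/ g = gensB.

(** At a time [d] between [1 / 7] and [1 / 6] the first speed is the one closest
    to the integers among the five speeds that do not involve [b]. *)
Lemma farAB (R : realType) g (d b : R) : product_plane g ->
  1 / 7 <= d -> d <= 1 / 6 -> d <= dist_int b -> far g d d b.
Proof.
move=> gAB d7 d6 db.
by case: gAB => ->; [apply/farA | apply/farB]; do !split=> //;
  first [by apply: (@dist_int_ge _ _ _ 0); lra |
         by apply: (@dist_int_ge _ _ _ 1); lra].
Qed.

Lemma reaches_wide (R : realType) g (A B : int) : product_plane g ->
  1 < A -> reaches g A B (1 / 6 : R).
Proof.
move=> gAB A1; have A2 : 2 <= A%:~R :> R by rewrite (ler_int R 2); lia.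
(* above [a = 1 / 6] the subtorus has the points with [b] in a coset of
   [(1 / A) Z], whose gaps are shorter than the interval [1 / 6, 5 / 6] *)
set n := Num.floor ((B%:~R - A%:~R) / 6 : R).
have /andP[n0 n1] := floor_itv ((B%:~R - A%:~R) / 6 : R); rewrite -/n intrD in n0 n1.
exists (1 / 6), ((B%:~R / 6 - n%:~R) / A%:~R), n; split.
  by field; rewrite gt_eqF //; lra.
refine (farAB gAB _ _ _); [lra | lra | apply: (@dist_int_ge _ _ _ 0)].
  by rewrite add0r ler_pdivlMr; lra.
by rewrite ler_pdivrMr; lra.
Qed.

Lemma reaches_nonmultiple (R : realType) g (B : int) :
  product_plane g -> (B <> 0 %[mod 6])%Z -> reaches g 1 B (1 / 6 : R).
Proof.
move=> gAB B6; exists (1 / 6), (B%:~R / 6), 0; split; first by field.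
refine (farAB gAB _ _ _); [lra | lra | apply: (@dist_int_ge _ _ _ (B %/ 6)%Z)].
  have : (6 * (B %/ 6)%Z + 1)%:~R <= B%:~R :> R by rewrite ler_int; lia.
  by rewrite intrD intrM; lra.
have : B%:~R <= (6 * (B %/ 6)%Z + 5)%:~R :> R by rewrite ler_int; lia.
by rewrite !intrD intrM; lra.
Qed.

Lemma reaches_reflectAB (R : realType) g (A B : int) (d : R) :
  product_plane g -> reaches g A B d -> reaches g A (- B) d.
Proof.
move=> gAB [a] [b] [n] [line f]; exists (- a), b, n; split.
  by rewrite intrN -line; ring.
by move: f; case: gAB => ->; [rewrite !farA | rewrite !farB];
  rewrite ?mulrN !dist_intN.
Qed.

(** The time is [1 / 6 - 1 / (6 P)] itself, where the first and the last speeds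
    are equally close to the integers. *)
Lemma reaches_multiple (R : realType) g (m P : int) :
  product_plane g -> 0 < m -> P = 6 * m + 1 ->
  reaches g 1 (6 * m) ((P - 1)%:~R / (6 * P)%:~R : R).
Proof.
move=> gAB m0 PE; have m1 : 1 <= m%:~R :> R by rewrite (ler_int R 1); lia.
set d : R := (P - 1)%:~R / (6 * P)%:~R; have dE : d * (6 * m%:~R + 1) = m%:~R.
  rewrite /d PE addrK !(intrD, intrM) /=; field; rewrite gt_eqF //; lra.
have d7 : 1 / 7 <= d.
  by rewrite /d PE addrK !(intrD, intrM) ler_pdivlMr; lra.
have d6 : d <= 1 / 6.
  by rewrite /d PE addrK !(intrD, intrM) ler_pdivrMr; lra.
exists d, (6 * m%:~R * d), 0; split; first by rewrite !(intrM); ring.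
refine (farAB gAB _ _ _) => //; rewrite mulrDr mulr1 in dE.
have -> : 6 * m%:~R * d = - d + m%:~R by rewrite -[X in _ = _ + X]dE; ring.
by rewrite dist_intD dist_intN; apply: (@dist_int_ge _ _ _ 0); lra.
Qed.

Lemma fold_half (R : realType) (a : R) : exists2 a', 0 <= a' <= 1 / 2 &
  forall k : int, dist_int (k%:~R * a') = dist_int (k%:~R * a).
Proof.
have /andP[a0 a1] := floor_itv a; move: a0 a1; set n := Num.floor a.
rewrite intrD => a0 a1; have [half|half] := lerP (a - n%:~R) (1 / 2).
  exists (a - n%:~R) => [|k]; first by apply/andP; split; lra.
  have -> : k%:~R * (a - n%:~R) = k%:~R * a + (- k * n)%:~R by ring.
  exact: dist_intD.
exists (1 - (a - n%:~R)) => [|k]; first by apply/andP; split; lra.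
have -> : k%:~R * (1 - (a - n%:~R)) = - (k%:~R * a) + (k * (n + 1))%:~R by ring.
by rewrite dist_intD dist_intN.
Qed.

(** The last speed is at an integer at the time [1 / 6], so a time
    [1 / 6 - x] or [1 / 6 + x] gives it the distance [6 m x] at most, while the
    first speed, respectively the speed 5, falls to [1 / 6 - x], respectively
    [1 / 6 - 5 x]. The best compromise is [x = 1 / (6 (6 m + 1))], before
    [1 / 6]. *)
Lemma near_sixth (R : realType) (m : int) (a d : R) : 0 < m ->
  0 <= a -> a <= 1 / 5 -> d <= a -> (1 / 6 < a -> d <= 1 - 5 * a) ->
  d <= dist_int ((6 * m)%:~R * a) -> d * (6 * m%:~R + 1) <= m%:~R.
Proof.
move=> m0 a0 a5 da da5 /(le_dist_int m).
have {}m0 : 1 <= m%:~R :> R by rewrite (ler_int R 1); lia.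
have -> : (6 * m)%:~R * a - m%:~R = m%:~R * (6 * a - 1) by ring.
rewrite normrM (ger0_norm (x := m%:~R)); last lra.
have [a6|a6] := ltrP (1 / 6) a.
  rewrite ger0_norm; last lra.
  move: (da5 a6) => da5' dm.
  have : m%:~R * (6 * d) <= m%:~R * (6 - 30 * a) by rewrite ler_wpM2l; lra.
  by case: (lerP 0 d) => d0; [nra | nra].
rewrite ler0_norm; last lra.
have : m%:~R * d <= m%:~R * a by rewrite ler_wpM2l; lra.
lra.
Qed.

Lemma reaches1_half (R : realType) g (B : int) (d : R) : reaches g 1 B d ->
  exists a, [/\ 0 <= a, a <= 1 / 2 & far g d a (B%:~R * a)].
Proof.
move=> [a] [b] [n] [line f].
have [a' /andP[a0 a1] distE] := fold_half a; exists a'; split=> // i.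
have := far_shift 0 n f i; rewrite -line addr0 mul1r addrCA subrr addr0.
set u := g.1 _ _; set v := g.2 _ _.
have E x : u%:~R * x + v%:~R * (B%:~R * x) = (u + v * B)%:~R * x :> R by ring.
by rewrite !E distE.
Qed.

(** Away from [1 / 6] the five fixed speeds alone give at most [1 / 7]; this is no
    more than [m / (6 m + 1)]. *)
Lemma reaches_leA (R : realType) (m : int) (d : R) : 0 < m ->
  reaches gensA 1 (6 * m) d -> d <= 1 / 7 \/ d * (6 * m%:~R + 1) <= m%:~R.
Proof.
move=> m0 /reaches1_half[a [a0 a1 /farA[[f1 f2 f3] f4 f5 f6]]].
have [a5|a5] := lerP a (1 / 5).
  right; apply: (near_sixth m0 a0 a5) f6 => [|_].
    by apply: (@dist_int_above _ _ a _ 0); first [done | ring].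
  by apply: (@dist_int_below _ _ (5 * a) _ 1); first [done|lra|ring].
left; have [a4|a4] := lerP a (1 / 4).
  have : d <= 5 * a - 1.
    by apply: (@dist_int_above _ _ (5 * a) _ 1); first [done|lra|ring].
  have : d <= 1 - 4 * a.
    by apply: (@dist_int_below _ _ (4 * a) _ 1); first [done|lra|ring].
  by lra.
have d4 : d <= 4 * a - 1.
  by apply: (@dist_int_above _ _ (4 * a) _ 1); first [done|lra|ring].
have [a3|a3] := lerP a (1 / 3).
  have : d <= 1 - 3 * a.
    by apply: (@dist_int_below _ _ (3 * a) _ 1); first [done|lra|ring].
  by lra.
have d3 : d <= 3 * a - 1.
  by apply: (@dist_int_above _ _ (3 * a) _ 1); first [done|lra|ring].
have [a52|a52] := lerP a (2 / 5).
  have : d <= 2 - 5 * a.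
    by apply: (@dist_int_below _ _ (5 * a) _ 2); first [done|lra|ring].
  by lra.
have : d <= 5 * a - 2.
  by apply: (@dist_int_above _ _ (5 * a) _ 2); first [done|lra|ring].
have : d <= 1 - 2 * a.
  by apply: (@dist_int_below _ _ (2 * a) _ 1); first [done|lra|ring].
by lra.
Qed.

(** The speeds [1, 3, 4, 5, 9] have a second local maximum of the smallest
    distance, [2 / 13] at the time [6 / 13]; it exceeds [m / (6 m + 1)] for
    [m = 1] and equals it for [m = 2]. *)
Lemma reaches_leB (R : realType) (m : int) (d : R) : 0 < m ->
  reaches gensB 1 (6 * m) d -> d <= 2 / 13 \/ d * (6 * m%:~R + 1) <= m%:~R.
Proof.
move=> m0 /reaches1_half[a [a0 a1 /farB[[f1 f3 f4] f5 f9 f6]]].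
have [a5|a5] := lerP a (1 / 5).
  right; apply: (near_sixth m0 a0 a5) f6 => [|_].
    by apply: (@dist_int_above _ _ a _ 0); first [done | ring].
  by apply: (@dist_int_below _ _ (5 * a) _ 1); first [done|lra|ring].
left; have [a4|a4] := lerP a (1 / 4).
  have : d <= 5 * a - 1.
    by apply: (@dist_int_above _ _ (5 * a) _ 1); first [done|lra|ring].
  have : d <= 1 - 4 * a.
    by apply: (@dist_int_below _ _ (4 * a) _ 1); first [done|lra|ring].
  by lra.
have d4 : d <= 4 * a - 1.
  by apply: (@dist_int_above _ _ (4 * a) _ 1); first [done|lra|ring].
have d42 : d <= 2 - 4 * a.
  by apply: (@dist_int_below _ _ (4 * a) _ 2); first [done|lra|ring].
have [a3|a3] := lerP a (1 / 3).
  have : d <= 1 - 3 * a.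
    by apply: (@dist_int_below _ _ (3 * a) _ 1); first [done|lra|ring].
  by lra.
have d3 : d <= 3 * a - 1.
  by apply: (@dist_int_above _ _ (3 * a) _ 1); first [done|lra|ring].
have [a52|a52] := lerP a (2 / 5).
  have : d <= 2 - 5 * a.
    by apply: (@dist_int_below _ _ (5 * a) _ 2); first [done|lra|ring].
  by lra.
have d52 : d <= 5 * a - 2.
  by apply: (@dist_int_above _ _ (5 * a) _ 2); first [done|lra|ring].
have [a9|a9] := lerP a (4 / 9).
  have : d <= 4 - 9 * a.
    by apply: (@dist_int_below _ _ (9 * a) _ 4); first [done|lra|ring].
  by lra.
have : d <= 9 * a - 4.
  by apply: (@dist_int_above _ _ (9 * a) _ 4); first [done|lra|ring].
by lra.
Qed.

Lemma reaches_six (R : realType) : reaches gensB 1 6 (2 / 13 : R).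
Proof.
exists (6 / 13), (36 / 13), 0; split; first by field.
apply/farB; do !split;
  [apply: (@dist_int_ge _ _ _ 0) | apply: (@dist_int_ge _ _ _ 1) |
   apply: (@dist_int_ge _ _ _ 1) | apply: (@dist_int_ge _ _ _ 2) |
   apply: (@dist_int_ge _ _ _ 4) | apply: (@dist_int_ge _ _ _ 2)]; lra.
Qed.

(** In the exceptional case of the speeds [1, 3, 4, 5, 9, 6], the value [2 / 13]
    is still of the form [(P - 1) / (6 P)], with [P = 13]. *)
Lemma ML_product_pos (R : realType) g (A B : int) : product_plane g ->
  0 < A -> coprimez A B -> distinct_nonzero_speeds (speed_vector g A B) ->
  ML (line_image R (speed_vector g A B)) < 1 / 6 ->
  exists P, [/\ 0 < P, (P = 1 %[mod 6])%Z &
    ML (line_image R (speed_vector g A B)) = (P - 1)%:~R / (6 * P)%:~R].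
Proof.
move=> gAB A0 coAB [nz _] small.
have no_sixth : ~ reaches g A B (1 / 6 : R).
  by move=> /(ML_ge coAB); rewrite leNgt small.
have A1 : A = 1.
  by have [/(reaches_wide R B gAB)|] := ltrP 1 A; [| lia].
move: A1 => {A0} A1; subst A.
have B6 : (B = 0 %[mod 6])%Z.
  apply/eqP; apply: contraT => /eqP /(reaches_nonmultiple R gAB) //.
have B0 : B != 0.
  have := nz (inord 5); case: gAB => ->; rewrite !mxE inordK //=; lia.
have [m m0 BE] : exists2 m, 0 < m & B = 6 * m \/ B = - (6 * m).
  by exists `|(B %/ 6)%Z|; lia.
have reachE d : reaches g 1 (6 * m) d <-> reaches g 1 B d :> Prop.
  case: BE => ->; first by [].
  split=> /(reaches_reflectAB gAB) //; by rewrite opprK.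
have m1 : 1 <= m%:~R :> R by rewrite (ler_int R 1); lia.
have from_bound P (c : R) : 0 < P -> (P = 1 %[mod 6])%Z ->
    c = (P - 1)%:~R / (6 * P)%:~R -> reaches g 1 (6 * m) c ->
    (forall d, reaches g 1 (6 * m) d -> d <= c) ->
    exists P, [/\ 0 < P, (P = 1 %[mod 6])%Z &
      ML (line_image R (speed_vector g 1 B)) = (P - 1)%:~R / (6 * P)%:~R].
  move=> P0 P1 cE /reachE rc max; exists P; split; rewrite -?cE //.
  by apply: (ML_max coAB rc) => d /reachE; apply: max.
have general d : d <= 1 / 7 \/ 1 < m /\ d <= 2 / 13 \/
    d * (6 * m%:~R + 1) <= m%:~R ->
    d <= (6 * m + 1 - 1)%:~R / (6 * (6 * m + 1))%:~R :> R.
  rewrite addrK !(intrD, intrM) => dm.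
  rewrite ler_pdivlMr; last by lra.
  suff : d * (6 * m%:~R + 1) <= m%:~R by lra.
  case: dm => [d7|[[m2 d13]|//]].
    have : d * (6 * m%:~R + 1) <= 1 / 7 * (6 * m%:~R + 1).
      by apply: ler_wpM2r; lra.
    by lra.
  have : d * (6 * m%:~R + 1) <= 2 / 13 * (6 * m%:~R + 1).
    by apply: ler_wpM2r; lra.
  have : 2 <= m%:~R :> R by rewrite (ler_int R 2); lia.
  by lra.
case: (gAB) => gE.
  apply: (from_bound (6 * m + 1) _ _ _ erefl).
  - lia.
  - lia.
  - by apply: reaches_multiple.
  - move=> d; rewrite gE => /(reaches_leA m0) dm; apply: general; tauto.
have [m2|m2] := ltrP 1 m.
  apply: (from_bound (6 * m + 1) _ _ _ erefl).
  - lia.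
  - lia.
  - by apply: reaches_multiple.
  - move=> d; rewrite gE => /(reaches_leB m0) dm; apply: general; tauto.
have mE : m = 1 by lia.
apply: (from_bound 13 (2 / 13)) => //.
- by field.
- by rewrite gE mE; apply: reaches_six.
move=> d; rewrite gE => /(reaches_leB m0)[//|]; rewrite mE; lra.
Qed.

(** * Both signs of the parameters, and sharpness *)

Lemma speeds_first_nonzero g (A B : int) :
  [\/ g = gensA, g = gensB | g = gensC] ->
  distinct_nonzero_speeds (speed_vector g A B) -> A != 0.
Proof.
by move=> gABC [/(_ ord0) + _]; case: gABC => ->; rewrite !mxE /= mulr1 mulr0 addr0.
Qed.

Lemma ML_product (R : realType) g (A B : int) : product_plane g ->
  coprimez A B -> distinct_nonzero_speeds (speed_vector g A B) ->
  ML (line_image R (speed_vector g A B)) < 1 / 6 ->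
  exists P, [/\ 0 < P, (P = 1 %[mod 6])%Z &
    ML (line_image R (speed_vector g A B)) = (P - 1)%:~R / (6 * P)%:~R].
Proof.
move=> gAB coAB speeds small.
have A0 : A != 0.
  by apply: speeds_first_nonzero speeds; case: gAB; [constructor 1 | constructor 2].
have [Apos|Aneg] := ltrP 0 A; first exact: ML_product_pos.
rewrite -line_image_opp in small *; apply: ML_product_pos => //; first lia.
  by rewrite coprimeNz coprimezN.
exact: distinct_nonzero_speeds_opp.
Qed.

Lemma MLC (R : realType) (A B : int) : coprimez A B ->
  distinct_nonzero_speeds (speed_vector gensC A B) ->
  ML (line_image R (speed_vector gensC A B)) < 1 / 6 ->
  exists P, [/\ 0 < P,
    ML (line_image R (speed_vector gensC A B)) = (P - 1)%:~R / (6 * P)%:~R &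
    (P = 1 %[mod 6])%Z /\ (0 < A -> ~ k3_case A B) /\
      (forall i, `|speed_vector gensC A B ord0 i| < 3 * P) \/
    (P = 5 %[mod 6])%Z /\ (0 < A -> k3_case A B) /\
      (forall i, `|speed_vector gensC A B ord0 i| < 9 * P)].
Proof.
move=> coAB speeds small.
have A0 : A != 0 by apply: speeds_first_nonzero speeds; constructor 3.
have [Apos|Aneg] := ltrP 0 A.
  have [P [P0 PE cases]] := MLC_pos Apos coAB speeds small.
  by exists P; split=> //; tauto.
have normE i : `|speed_vector gensC (- A) (- B) ord0 i| =
    `|speed_vector gensC A B ord0 i|.
  by rewrite !mxE -normrN; congr `|_|; lia.
rewrite -line_image_opp in small *.
have [||P [P0 PE cases]] := MLC_pos _ _ (distinct_nonzero_speeds_opp speeds) small.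
- by lia.
- by rewrite coprimeNz coprimezN.
exists P; split=> //.
case: cases => [[P1 [_ le]]|[P5 [_ le]]]; [left | right].
  by split=> //; split=> [?|i]; [lia | rewrite -normE].
by split=> //; split=> [?|i]; [lia | rewrite -normE].
Qed.

Lemma max_speed_lt (v : 'rV[int]_6) (c : int) : 0 < c ->
  (forall i, `|v ord0 i| < c) -> (max_speed v)%:Z < c.
Proof.
move=> c0 lt_c; have -> : c = (`|c|.-1.+1)%N by lia.
rewrite ltz_nat ltnS; apply/bigmax_leqP => i _.
by have := lt_c i; lia.
Qed.

Lemma exact_denominator10 (A B : int) : 0 < A -> 0 < B ->
  (A = 1 %[mod 6])%Z -> (B = 0 %[mod 6])%Z -> exact_denominator A B (A + 2 * B).
Proof. by move=> A0 B0 rA rB; exact_denominator_at (A + B, - B). Qed.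

Lemma max_speed_ratio_sharp (R : realType) (c : R) : c < 3 ->
  exists (T : set (torus R 6)) (A B : int) (r : rat),
    [/\ small_ML_subtorus gensC T A B, ML T = ratr r &
        c * (denq r)%:~R <= (max_speed (speed_vector gensC A B))%:R].
Proof.
move=> c3.
(* [max_speed / q = (18 m + 15) / (6 m + 13)], and [3 q - max_speed = 24] *)
have [m m0 cm] : exists2 m : int, 0 <= m & 24 <= (3 - c) * (6 * m + 13)%:~R.
  exists `|Num.ceil (4 / (3 - c))| => //.
  have : 4 / (3 - c) <= `|Num.ceil (4 / (3 - c))|%:~R :> R.
    by apply: le_trans (Num.Theory.ceil_ge _) _; rewrite ler_int ler_norm.
  rewrite ler_pdivrMr; last by lra.
  have : 0 <= (3 - c) * 13 by apply: mulr_ge0; lra.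
  by rewrite intrD intrM; lra.
pose A : int := 6 * m + 1; pose P : int := A + 2 * 6.
have coA : coprimez A 6 by apply/coprimezP; exists (1, - m); rewrite /A /=; lia.
have P0 : 0 < P by rewrite /P /A; lia.
have P1 : (P = 1 %[mod 6])%Z by rewrite /P /A; lia.
have [reach max] := exact_denominator_max R P0
  (exact_denominator10 (A := A) (B := 6) ltac:(lia) ltac:(lia) ltac:(lia) ltac:(lia)).
have ML_E := ML_max coA reach max.
have E i : speed_vector gensC A 6 ord0 i =
    [:: 6 * m + 1; 6; 6 * m + 7; 12 * m + 8; 18 * m + 9; 18 * m + 15]`_i.
  by rewrite !mxE /A; case: i => [[|[|[|[|[|[|]]]]]]] //= _; lia.
exists (line_image R (speed_vector gensC A 6)), A, 6,
  ((P - 1)%:~R / (6 * P)%:~R).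
have [_ ->] := value_residue1 P0 P1.
split; last 1 first.
- have le_max : (3 * A + 2 * 6)%:~R <=
      (max_speed (speed_vector gensC A 6))%:R :> R.
    rewrite [leRHS]pmulrn ler_int.
    have := leq_bigmax (F := fun i => `|speed_vector gensC A 6 ord0 i|%N)
      (inord 5 : 'I_6).
    rewrite -/(max_speed _) E inordK //= /A; lia.
  apply: le_trans le_max; move: cm.
  by rewrite /P /A !(intrD, intrM); lra.
- split.
  + split; last first.
      move=> _ [t _ <-]; exists (t * A%:~R) => //; exists (t * 6) => //.
      by congr to_torus; apply/rowP => i; rewrite !mxE !(intrD, intrM); ring.
    exists (speed_vector gensC A 6) => //.
    apply/eqP => /rowP /(_ ord0); rewrite E mxE /=; lia.
  + by split.
  + split=> [i|i j].
      by rewrite E; case: i => [[|[|[|[|[|[|]]]]]]] //= _; lia.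
    rewrite !E -val_eqE.
    case: i => [[|[|[|[|[|[|]]]]]]] //= _; case: j => [[|[|[|[|[|[|]]]]]]] //= _ _;
      lia.
  + rewrite ML_E ltr_pdivrMr ?ltr0z ?pmulr_rgt0 //.
    by rewrite intrM intrB; lra.
- by rewrite ML_E ratr_value.
Qed.

(** * The theorem *)

Theorem theoremB (R : realType) :
  (forall (g : generators) (T : set (torus R 6)) (A B : int),
     [\/ g = gensA, g = gensB | g = gensC] ->
     small_ML_subtorus g T A B ->
     exists2 r : rat, ML T = ratr r &
       let p := numq r in
       let q := denq r in
       let k := q - 6 * p in
       [/\ exists P : int,
             ((P = 1 %[mod 6])%Z \/ (P = -1 %[mod 6])%Z) /\
             ML T = (P - 1)%:~R / (6 * P)%:~R,
           (k = 1 \/ k = 3) /\ ~~ (2 %| q)%Z,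
           g = gensA \/ g = gensB -> k = 1,
           g = gensC -> 0 < A ->
             (k = 3 <-> k3_case A B) /\ (~ k3_case A B -> k = 1) &
           g = gensC -> (max_speed (speed_vector g A B))%:Z < 3 * q]) /\
  (forall c : R, c < 3 ->
     exists (T : set (torus R 6)) (A B : int) (r : rat),
       [/\ small_ML_subtorus gensC T A B, ML T = ratr r &
           c * (denq r)%:~R <= (max_speed (speed_vector gensC A B))%:R]).
Proof.
have C_neq_A : gensC <> gensA.
  by move=> /(congr1 (fun g : generators => g.1 ord0 (inord 1))); rewrite !mxE inordK.
have C_neq_B : gensC <> gensB.
  by move=> /(congr1 (fun g : generators => g.1 ord0 (inord 1))); rewrite !mxE inordK.
split; last exact: max_speed_ratio_sharp.
move=> g T A B gABC [_ [coAB ->] speeds small].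
have [gC|gAB] : g = gensC \/ product_plane g.
  by case: gABC; [right; left | right; right | left].
  have not_AB : ~ (g = gensA \/ g = gensB) by rewrite gC; case.
  rewrite gC in speeds small *.
  have [P [P0 PE cases]] := MLC coAB speeds small.
  exists ((P - 1)%:~R / (6 * P)%:~R); first by rewrite PE ratr_value.
  case: cases => [[P1 [k3 le]]|[P5 [k3 le]]].
    have [nE dE] := value_residue1 P0 P1; rewrite /= nE dE; split.
    - by exists P; split; [left |].
    - by split; [left; lia | lia].
    - by case.
    - by move=> _ /k3 nk3; split=> [|_]; [split=> [|//]; lia | lia].
    - by move=> _; apply: max_speed_lt le; lia.
  have [nE dE] := value_residue5 P0 P5; rewrite /= dE.
  move: nE; set n := numq _ => nE.
  have -> : 3 * P - 6 * n = 3 by lia.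
  split.
  - by exists P; split; [right; lia |].
  - by split; [right | lia].
  - by case.
  - by move=> _ /k3 k3'; split.
  - move=> _; have -> : 3 * (3 * P) = 9 * P by lia.
    by apply: max_speed_lt le; lia.
have [P [P0 P1 PE]] := ML_product gAB coAB speeds small.
exists ((P - 1)%:~R / (6 * P)%:~R); first by rewrite PE ratr_value.
have [nE dE] := value_residue1 P0 P1; rewrite /= nE dE; split.
- by exists P; split; [left |].
- by split; [left; lia | lia].
- by move=> _; lia.
- by move=> gC; case: gAB; rewrite gC.
- by move=> gC; case: gAB; rewrite gC.
Qed.
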